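(* For any number of tests $n$, there exists some distribution $P(\mathbf{X})$ on test matrices $\mathbf{X} \in \{0,1\}^{n \times p}$ such that, given $(\mathbf{X},\mathbf{Y})$, the group testing joint distribution $P(\mathbf{X},\mathbf{Y})$ can be distinguished from $Q(\mathbf{X},\mathbf{Y}) := P(\mathbf{X})P(\mathbf{Y})$ by a hypothesis test with zero error probability under $P$ and error probability $2^{-n}$ (i.e., success probability $1-2^{-n}$) under $Q$.
   Context: Probabilistic (noiseless) group testing: there are $p$ items $\{1,\dots,p\}$ and the defective set $S$ is uniformly distributed over the $\binom{p}{k}$ subsets of $\{1,\dots,p\}$ of cardinality $k$, where $1 \le k \le p$. Given a distribution $P(\mathbf{X})$ on test matrices $\mathbf{X} \in \{0,1\}^{n\times p}$ ($X^{(i)}_j = 1$ iff item $j$ is in test $i$), with $\mathbf{X}$ independent of $S$, the outcomes are $\mathbf{Y}\in\{0,1\}^n$ with $Y^{(i)} = \bigvee_{j\in S} X^{(i)}_j$. $P(\mathbf{X},\mathbf{Y})$ denotes the resulting joint distribution of $(\mathbf{X},\mathbf{Y})$ (with $S$ averaged out), $P(\mathbf{Y})$ its $\mathbf{Y}$-marginal, and $Q$ is the product of its marginals. A hypothesis test is a rule mapping the observed $(\mathbf{X},\mathbf{Y})$ to a decision ''$P$'' or ''$Q$''; the error probability under $P$ (resp. $Q$) is the probability of deciding $Q$ (resp. $P$) when $(\mathbf{X},\mathbf{Y})$ is drawn from $P$ (resp. $Q$). *)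

(* Defs.v *)
From HB Require Import structures.
From mathcomp Require Import all_boot all_order all_algebra reals.

Set Implicit Arguments.
Unset Strict Implicit.
Unset Printing Implicit Defensive.

Import Order.TTheory GRing.Theory Num.Theory.
Local Open Scope ring_scope.

Record fdist (R : realType) (T : finType) := FDist {
  pmf :> {ffun T -> R};
  pmf_ge0 : forall x, 0 <= pmf x;
  pmf_sum1 : \sum_x pmf x = 1
}.

Definition Pr (R : realType) (T : finType) (d : fdist R T) (A : {set T}) : R :=
  \sum_(x in A) d x.

Section Constructions.
Variable R : realType.

Section Uniform.
Variables (T : finType) (A : {set T}) (A_gt0 : (0 < #|A|)%N).

Let unif_fun : {ffun T -> R} :=
  [ffun x => if x \in A then #|A|%:R^-1 else 0].

Let unif_ge0 x : 0 <= unif_fun x.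
Proof. by rewrite ffunE; case: ifP => // _; rewrite invr_ge0. Qed.

Let unif_sum1 : \sum_x unif_fun x = 1.
Proof.
under eq_bigr do rewrite ffunE.
rewrite -big_mkcond /= sumr_const -[LHS]mulr_natr mulVf //.
by rewrite pnatr_eq0 -lt0n.
Qed.

Definition fdist_unif : fdist R T := FDist unif_ge0 unif_sum1.
End Uniform.

Section Product.
Variables (T1 T2 : finType) (d1 : fdist R T1) (d2 : fdist R T2).

Let prod_fun : {ffun T1 * T2 -> R} := [ffun w => d1 w.1 * d2 w.2].

Let prod_ge0 w : 0 <= prod_fun w.
Proof. by rewrite ffunE mulr_ge0 ?pmf_ge0. Qed.

Let prod_sum1 : \sum_w prod_fun w = 1.
Proof.
under eq_bigr do rewrite ffunE.
rewrite -(pair_bigA _ (fun x y => d1 x * d2 y)) /=.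
under eq_bigr do rewrite -mulr_sumr pmf_sum1 mulr1.
exact: pmf_sum1.
Qed.

Definition fdist_prod : fdist R (T1 * T2)%type := FDist prod_ge0 prod_sum1.
End Product.

Section Image.
Variables (T U : finType) (f : T -> U) (d : fdist R T).

Let map_fun : {ffun U -> R} := [ffun u => \sum_(x | f x == u) d x].

Let map_ge0 u : 0 <= map_fun u.
Proof. by rewrite ffunE sumr_ge0 // => x _; apply: pmf_ge0. Qed.

Let map_sum1 : \sum_u map_fun u = 1.
Proof.
under eq_bigr do rewrite ffunE.
by rewrite -(pmf_sum1 d) [RHS](partition_big f xpredT).
Qed.

Definition fdist_map : fdist R U := FDist map_ge0 map_sum1.
End Image.

End Constructions.

Section GroupTesting.
Variables (R : realType) (n p k : nat).

Definition ksubsets : {set {set 'I_p}} := [set S : {set 'I_p} | #|S| == k].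

Lemma ksubsets_gt0 : (k <= p)%N -> (0 < #|ksubsets|)%N.
Proof. by move=> le_kp; rewrite card_draws card_ord bin_gt0. Qed.

Definition outcome (X : 'M[bool]_(n, p)) (S : {set 'I_p}) : 'cV[bool]_n :=
  \col_i [exists j in S, X i j].

Variable le_kp : (k <= p)%N.

Definition defective_law : fdist R {set 'I_p} :=
  fdist_unif R (ksubsets_gt0 le_kp).

(* fdist_prod encodes the independence of X and S; S is then averaged out. *)
Definition jointP (PX : fdist R 'M[bool]_(n, p)) :
    fdist R ('M[bool]_(n, p) * 'cV[bool]_n)%type :=
  fdist_map (fun w => (w.1, outcome w.1 w.2)) (fdist_prod PX defective_law).

Definition prodQ (PX : fdist R 'M[bool]_(n, p)) :
    fdist R ('M[bool]_(n, p) * 'cV[bool]_n)%type :=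
  fdist_prod (fdist_map fst (jointP PX)) (fdist_map snd (jointP PX)).
End GroupTesting.

(* A test of P against Q is a map phi : T -> bool, where phi w = true means
   that the decision on observing w is "P", and false that it is "Q". *)
Section HypothesisTesting.
Variables (R : realType) (T : finType) (P Q : fdist R T) (phi : T -> bool).

Definition errorP : R := Pr P [set w | ~~ phi w].
Definition errorQ : R := Pr Q [set w | phi w].
Definition successQ : R := Pr Q [set w | ~~ phi w].
End HypothesisTesting.

(* Main.v *)
(** Let every row of X be constant, with value an independent fair bit.  Since
    S is nonempty, the outcome of a test is the bit of its row, so under P the
    outcome vector Y is determined by X, while Y is uniform on {0,1}^n.  Hence
    the test "Y is the vector of bits read off X" never fails under P, and it
    succeeds with probability 2^-n when Y is resampled independently of X. *)

Require Import Defs.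
From mathcomp Require Import all_boot all_order all_algebra reals.

Import GRing.Theory.
Local Open Scope ring_scope.

Section Expectation.
Context {R : realType}.

(** Turns a probability into the expectation of an indicator, the form to which the expectation
    rules for images and products below apply. *)
Lemma PrE {T : finType} (d : fdist R T) (A : {set T}) :
  Pr d A = \sum_x d x * (x \in A)%:R.
Proof.
rewrite /Pr big_mkcond; apply: eq_bigr => x _.
by case: (x \in A); rewrite ?mulr1 ?mulr0.
Qed.

Lemma Pr_setC {T : finType} (d : fdist R T) (A : {set T}) :
  Pr d (~: A) = 1 - Pr d A.
Proof.
rewrite -(pmf_sum1 d) (bigID (mem A)) /= addrAC subrr add0r.
by apply: eq_bigl => x; rewrite inE.
Qed.

Lemma sum_fdist_map {T U : finType} (f : T -> U) (d : fdist R T) (g : U -> R) :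
  \sum_u fdist_map f d u * g u = \sum_x d x * g (f x).
Proof.
rewrite [RHS](partition_big f xpredT) //=; apply: eq_bigr => u _.
by rewrite ffunE mulr_suml; apply: eq_bigr => x /eqP <-.
Qed.

Lemma sum_fdist_prod {T U : finType} (d : fdist R T) (e : fdist R U)
    (g : T * U -> R) :
  \sum_w fdist_prod d e w * g w = \sum_x d x * \sum_y e y * g (x, y).
Proof.
under [RHS]eq_bigr do rewrite mulr_sumr.
rewrite pair_bigA /=; apply: eq_bigr => -[x y] _.
by rewrite ffunE mulrA.
Qed.

Lemma sum_fdist_cst {T : finType} (d : fdist R T) (a : R) :
  \sum_x d x * a = a.
Proof. by rewrite -mulr_suml pmf_sum1 mul1r. Qed.

End Expectation.

Section ConstantRows.
Variables (R : realType) (n p k : nat) (k_gt0 : (1 <= k)%N) (le_kp : (k <= p)%N).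

Definition row_constant (c : 'cV[bool]_n) : 'M[bool]_(n, p) :=
  \matrix_(i, j) c i 0.

(** A disjunction of copies of one bit is that bit; an empty [S] would give false instead. *)
Lemma outcome_row_constant (c : 'cV[bool]_n) (S : {set 'I_p}) :
  (0 < #|S|)%N -> outcome (row_constant c) S = c.
Proof.
case/card_gt0P=> j jS; apply/colP => i; rewrite mxE.
by apply/existsP/idP => [[j' /andP[_]]|ci]; [|exists j; rewrite jS]; rewrite mxE.
Qed.

Lemma cV_bool_gt0 : (0 < #|[set: 'cV[bool]_n]|)%N.
Proof. by apply/card_gt0P; exists (const_mx false); rewrite inE. Qed.

Definition fair_bits : fdist R 'cV[bool]_n := fdist_unif R cV_bool_gt0.

Definition fair_rows : fdist R 'M[bool]_(n, p) :=
  fdist_map row_constant fair_bits.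

Lemma fair_bitsE c : fair_bits c = 2 ^- n.
Proof. by rewrite ffunE inE cardsT card_mx card_bool muln1 natrX. Qed.

Lemma sum_defective_law (g : {set 'I_p} -> R) (a : R) :
  (forall S : {set 'I_p}, #|S| = k -> g S = a) ->
  \sum_S defective_law R le_kp S * g S = a.
Proof.
move=> ga; rewrite -[RHS](sum_fdist_cst (defective_law R le_kp)).
apply: eq_bigr => S _; rewrite ffunE inE.
by case: eqP => [/ga ->|_]; rewrite ?mul0r.
Qed.

(** Every [S] of size [k] is nonempty and yields the same outcome [c], so averaging over [S] has no
    effect. *)
Lemma sum_jointP (g : 'M[bool]_(n, p) * 'cV[bool]_n -> R) :
  \sum_w jointP le_kp fair_rows w * g w =
  \sum_c fair_bits c * g (row_constant c, c).
Proof.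
rewrite sum_fdist_map sum_fdist_prod sum_fdist_map; apply: eq_bigr => c _.
congr (_ * _); apply: sum_defective_law => S Sk /=.
by rewrite outcome_row_constant ?Sk.
Qed.

(** Both factors of [prodQ] are marginals of [jointP], so [sum_jointP] is used twice, giving two
    independent bit vectors. *)
Lemma sum_prodQ (g : 'M[bool]_(n, p) * 'cV[bool]_n -> R) :
  \sum_w prodQ le_kp fair_rows w * g w =
  \sum_c fair_bits c * \sum_c' fair_bits c' * g (row_constant c, c').
Proof.
rewrite sum_fdist_prod sum_fdist_map.
set marginalY := fdist_map snd _.
rewrite (sum_jointP (fun w => \sum_y marginalY y * g (w.1, y))).
apply: eq_bigr => c _; congr (_ * _).
by rewrite /marginalY sum_fdist_map (sum_jointP (fun w => g (row_constant c, w.2))).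
Qed.

End ConstantRows.

Theorem proposition1 (R : realType) (p k : nat) (k_gt0 : (1 <= k)%N)
    (le_kp : (k <= p)%N) (n : nat) :
  exists PX : fdist R 'M[bool]_(n, p),
  exists phi : 'M[bool]_(n, p) * 'cV[bool]_n -> bool,
    [/\ errorP (jointP le_kp PX) phi = 0,
        errorQ (prodQ le_kp PX) phi = 2 ^- n &
        successQ (prodQ le_kp PX) phi = 1 - 2 ^- n].
Proof.
(* Declaring all items defective recovers the row bits from the matrix; [setT] is nonempty since
   [1 <= k <= p]. *)
pose phi (w : 'M[bool]_(n, p) * 'cV[bool]_n) := w.2 == outcome w.1 setT.
have phiE c c' : phi (row_constant n p c, c') = (c' == c).
  rewrite /phi /= outcome_row_constant // cardsT card_ord.
  exact: leq_trans le_kp.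
have errQ : errorQ (prodQ le_kp (fair_rows R n p)) phi = 2 ^- n.
  rewrite /errorQ PrE sum_prodQ //.
  (* Writing [2 ^- n] as an average over [c] allows [c] to be fixed; then only [c' = c] passes the
     test. *)
  rewrite -[RHS](sum_fdist_cst (fair_bits R n)); apply: eq_bigr => c _.
  congr (_ * _); rewrite (bigD1 c) //= inE phiE eqxx mulr1 fair_bitsE.
  by rewrite big1 ?addr0 // => c' /negPf ne; rewrite inE phiE ne mulr0.
exists (fair_rows R n p), phi; split=> //.
- rewrite /errorP PrE sum_jointP // big1 // => c _.
  by rewrite inE phiE eqxx mulr0.
- rewrite -errQ -Pr_setC; congr Pr.
  by apply/setP => w; rewrite !inE.
Qed.
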